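(* Let $(M,\mathfrak g,T)$ be an embedding tensor on a Malcev algebra, write $[x,m]:=\rho(x)(m)$ for the action of $x\in\mathfrak g$ on $m\in M$, and let $N=(N_0,N_1)$ be a Nijenhuis operator on it. Then a deformation of $(M,\mathfrak g,T)$ is obtained by putting $$\theta(m)=(T\circ N_0-N_1\circ T)(m),$$ $$\omega(x,y)=[N_1x,y]+[x,N_1y]-N_1[x,y],$$ $$\nu(x,m)=[N_1x,m]+[x,N_0m]-N_0[x,m],$$ that is, $(\theta,\omega,\nu)$ generates a 1-parameter infinitesimal deformation of $(M,\mathfrak g,T)$. Furthermore, this deformation is trivial.
   Context: All vector spaces and linear maps are over a fixed field of characteristic $0$. A Malcev algebra is a vector space $\mathfrak g$ with a skew-symmetric bilinear bracket satisfying $J(x,y,[x,z])=[J(x,y,z),x]$ for all $x,y,z$, where $J(x,y,z)=[[x,y],z]+[[y,z],x]+[[z,x],y]$. A representation of $\mathfrak g$ on a vector space $M$ is a linear map $\rho:\mathfrak g\to\operatorname{End}(M)$ with $\rho([[x,y],z])=\rho(x)\rho(y)\rho(z)-\rho(z)\rho(x)\rho(y)+\rho(y)\rho([z,x])-\rho([y,z])\rho(x)$. An embedding tensor $(M,\mathfrak g,T)$ on a Malcev algebra consists of a Malcev algebra $\mathfrak g$, a representation $(M,\rho)$ of $\mathfrak g$, and a linear map $T:M\to\mathfrak g$ with $[T(m),T(n)]=T(\rho(T(m))(n))$ for all $m,n\in M$. Nijenhuis operator: a pair of linear maps $N_0:M\to M$, $N_1:\mathfrak g\to\mathfrak g$ such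 that for all $x,y\in\mathfrak g$, $m\in M$: (i) $\operatorname{Im}(T\circ N_0-N_1\circ T)\subset\operatorname{Ker}N_1$; (ii) $N_1([x,y]_N)=[N_1x,N_1y]$, where $[x,y]_N=[N_1x,y]+[x,N_1y]-N_1[x,y]$; (iii) $N_0([x,m]_N)=[N_1x,N_0m]$, where $[x,m]_N=[N_1x,m]+[x,N_0m]-N_0[x,m]$. Given linear maps $\theta:M\to\mathfrak g$, $\omega:\wedge^2\mathfrak g\to\mathfrak g$, $\nu:\mathfrak g\otimes M\to M$ and a parameter $\lambda$, put $T_\lambda=T+\lambda\theta$, $[x,y]_\lambda=[x,y]+\lambda\omega(x,y)$, $[x,m]_\lambda=\rho_\lambda(x)(m)=\rho(x)(m)+\lambda\nu(x,m)$, and let $\mathfrak g_\lambda,M_\lambda$ be $\mathfrak g,M$ with these operations. $(\theta,\omega,\nu)$ generates a 1-parameter infinitesimal deformation if $(M_\lambda,\mathfrak g_\lambda,T_\lambda)$ is an embedding tensor on a Malcev algebra for all $\lambda$. Such a deformation is trivial if there are linear maps $N_0:M\to M$, $N_1:\mathfrak g\to\mathfrak g$ such that, with $T_0=\mathrm{id}+\lambda N_0$ and $T_1=\mathrm{id}+\lambda N_1$, the pair $(T_0,T_1)$ is a morphism from $(M_\lambda,\mathfrak g_\lambda,T_\lambda)$ to $(M,\mathfrak g,T)$, i.e. $T\circ T_0=T_1\circ T_\lambda$, $T_1([x,y]_\lambda)=[T_1x,T_1y]$ and $T_0([x,m]_\lambda)=[T_1x,T_0m]$ for all $x,y\in\mathfrak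 g$, $m\in M$. (In the notation $T_0,T_1$ the subscripts are labels, not values of $\lambda$.) *)

(* Defs.v *)
From HB Require Import structures.
From mathcomp Require Import all_boot all_order all_algebra.
Set Implicit Arguments.
Unset Strict Implicit.
Unset Printing Implicit Defensive.
Import GRing.Theory.
Local Open Scope ring_scope.

Section Malcev.
Variables (K : fieldType) (g : lmodType K).

Definition jacobian (br : g -> g -> g) (x y z : g) : g :=
  br (br x y) z + br (br y z) x + br (br z x) y.

Record is_malcev (br : g -> g -> g) : Prop := IsMalcev {
  malcev_bilinear : bilinear_for *:%R *:%R br;
  malcev_skew : forall x y, br x y = - br y x;
  malcev_identity : forall x y z,
    jacobian br x y (br x z) = br (jacobian br x y z) x }.

(* A linear map rho : g -> End(M) is given by its curried bilinear form
   g -> M -> M. *)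
Record is_representation (M : lmodType K)
    (br : g -> g -> g) (rho : g -> M -> M) : Prop := IsRepresentation {
  rep_bilinear : bilinear_for *:%R *:%R rho;
  rep_identity : forall x y z m,
    rho (br (br x y) z) m =
      rho x (rho y (rho z m)) - rho z (rho x (rho y m))
      + rho y (rho (br z x) m) - rho (br y z) (rho x m) }.

End Malcev.

(* The operations of a triple (M, g, T), without axioms: the deformed triples
   have to be written down before they are known to be embedding tensors. *)
Record triple (K : fieldType) (M g : lmodType K) := Triple {
  bracket : g -> g -> g;
  action : g -> M -> M;
  tensor : M -> g }.

Record is_embedding_tensor (K : fieldType) (M g : lmodType K)
    (E : triple M g) : Prop := IsEmbeddingTensor {
  et_malcev : is_malcev (bracket E);
  et_representation : is_representation (bracket E) (action E);
  et_linear : linear (tensor E);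
  et_identity : forall m n,
    bracket E (tensor E m) (tensor E n) =
      tensor E (action E (tensor E m) n) }.

Record is_morphism (K : fieldType) (M g M' g' : lmodType K)
    (E : triple M g) (E' : triple M' g') (T0 : M -> M') (T1 : g -> g') : Prop :=
  IsMorphism {
  morph_linear0 : linear T0;
  morph_linear1 : linear T1;
  morph_tensor : forall m, tensor E' (T0 m) = T1 (tensor E m);
  morph_bracket : forall x y,
    T1 (bracket E x y) = bracket E' (T1 x) (T1 y);
  morph_action : forall x m,
    T0 (action E x m) = action E' (T1 x) (T0 m) }.

Section Deformation.
Variables (K : fieldType) (M g : lmodType K) (E : triple M g).

Section NijenhuisMaps.
Variables (N0 : M -> M) (N1 : g -> g).

Definition nij_tensor (m : M) : g := tensor E (N0 m) - N1 (tensor E m).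

Definition nij_bracket (x y : g) : g :=
  bracket E (N1 x) y + bracket E x (N1 y) - N1 (bracket E x y).

Definition nij_action (x : g) (m : M) : M :=
  action E (N1 x) m + action E x (N0 m) - N0 (action E x m).

End NijenhuisMaps.

Record is_nijenhuis (N0 : {linear M -> M}) (N1 : {linear g -> g}) : Prop :=
  IsNijenhuis {
  nijenhuis_tensor : forall m, N1 (nij_tensor N0 N1 m) = 0;
  nijenhuis_bracket : forall x y,
    N1 (nij_bracket N1 x y) = bracket E (N1 x) (N1 y);
  nijenhuis_action : forall x m,
    N0 (nij_action N0 N1 x m) = action E (N1 x) (N0 m) }.

Variables (theta : M -> g) (omega : g -> g -> g) (nu : g -> M -> M).

Definition deform (lambda : K) : triple M g :=
  Triple (fun x y => bracket E x y + lambda *: omega x y)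
         (fun x m => action E x m + lambda *: nu x m)
         (fun m => tensor E m + lambda *: theta m).

(* Linear maps out of the exterior square (resp. the tensor product) are
   alternating bilinear (resp. bilinear) maps. *)
Record generates_deformation : Prop := GeneratesDeformation {
  theta_linear : linear theta;
  omega_bilinear : bilinear_for *:%R *:%R omega;
  omega_alternating : forall x, omega x x = 0;
  nu_bilinear : bilinear_for *:%R *:%R nu;
  deform_embedding_tensor : forall lambda, is_embedding_tensor (deform lambda) }.

(* N0 and N1 do not depend on lambda. *)
Definition is_trivial_deformation : Prop :=
  exists (N0 : {linear M -> M}) (N1 : {linear g -> g}),
    forall lambda : K,
      is_morphism (deform lambda) E
        (fun m => m + lambda *: N0 m) (fun x => x + lambda *: N1 x).

End Deformation.

(* Main.v *)
Require Import Defs.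
From HB Require Import structures.
From mathcomp Require Import all_boot all_order all_algebra.
Set Implicit Arguments.
Unset Strict Implicit.
Unset Printing Implicit Defensive.
Import GRing.Theory.
Local Open Scope ring_scope.

(** The Nijenhuis conditions say exactly that the maps id + lambda N0 and
    id + lambda N1 intertwine the deformed operations with the original ones
    ([nijenhuis_morphism]): comparing powers of lambda, the constant and linear
    terms agree by the choice of theta, omega and nu, and the quadratic terms
    agree by the three conditions on N. This is the triviality statement.

    It also yields the axioms of the deformed structure. If id + lambda N were
    injective, the axioms could be pulled back along it; but in infinite
    dimension it may fail to be injective for every nonzero lambda. What
    survives is the formal version of this argument. The two sides of each
    deformed axiom are polynomial in lambda, say their difference is
    D = D_0 + lambda D_1 + ..., and (id + lambda N) D(lambda) = 0 because the
    original structure satisfies the axiom. In characteristic 0 the field is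
    infinite, so the coefficients of this polynomial vanish, i.e. D_0 = 0 and
    D_(i+1) = - N D_i: hence D = 0 ([polynomial_map_line_inj]). In other words
    id + lambda N is invertible as a formal power series in lambda. *)

(** * Linear and bilinear maps *)

Section Linear.
Variables (K : fieldType) (U V W : lmodType K).
Implicit Types f h : U -> V.

Lemma lin0 f : linear f -> f 0 = 0.
Proof.
by move=> lf; have := lf (-1) 0 0; rewrite !scaleN1r oppr0 addr0 addNr.
Qed.

Lemma linD f : linear f -> {morph f : x y / x + y}.
Proof. by move=> lf x y; have := lf 1 x y; rewrite !scale1r. Qed.

Lemma linZ f : linear f -> forall a, {morph f : x / a *: x}.
Proof. by move=> lf a x; have := lf a x 0; rewrite !addr0 lin0 // addr0. Qed.

Lemma linB f : linear f -> {morph f : x y / x - y}.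
Proof. by move=> lf x y; rewrite -scaleN1r linD // linZ // scaleN1r. Qed.

Lemma linear_add f h : linear f -> linear h -> linear (fun x => f x + h x).
Proof. by move=> lf lh a x y; rewrite lf lh scalerDr addrACA. Qed.

Lemma linear_scale c f : linear f -> linear (fun x => c *: f x).
Proof. by move=> lf a x y; rewrite lf scalerDr !scalerA mulrC. Qed.

Lemma linear_sub f h : linear f -> linear h -> linear (fun x => f x - h x).
Proof. by move=> lf lh a x y; rewrite lf lh scalerBr opprD addrACA. Qed.

Lemma linear_comp (p : V -> W) f :
  linear p -> linear f -> linear (fun x => p (f x)).
Proof. by move=> lp lf a x y; rewrite lf lp. Qed.

End Linear.

Section Bilinear.
Variables (K : fieldType) (U V W : lmodType K).

Definition bilin (b : U -> V -> W) := bilinear_for *:%R *:%R b.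

Lemma bilin_addscale (b w : U -> V -> W) (c : K) :
  bilin b -> bilin w -> bilin (fun x y => b x y + c *: w x y).
Proof.
move=> [bl br] [wl wr]; split=> z.
  exact: linear_add (bl z) (linear_scale c (wl z)).
exact: linear_add (br z) (linear_scale c (wr z)).
Qed.

Variable b : U -> V -> W.
Hypothesis bb : bilin b.

Lemma bilinDl x y z : b (x + y) z = b x z + b y z.
Proof. exact: (linD (bb.1 z)). Qed.
Lemma bilinDr z x y : b z (x + y) = b z x + b z y.
Proof. exact: (linD (bb.2 z)). Qed.
Lemma bilinZl a x z : b (a *: x) z = a *: b x z.
Proof. exact: (linZ (bb.1 z)). Qed.
Lemma bilinZr a z x : b z (a *: x) = a *: b z x.
Proof. exact: (linZ (bb.2 z)). Qed.

End Bilinear.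

(** * The pencil id + t N and the Nijenhuis product *)

Definition line (K : fieldType) (V : lmodType K) (N : V -> V) (t : K) (x : V) :=
  x + t *: N x.

Lemma line_linear (K : fieldType) (V : lmodType K) (N : V -> V) t :
  linear N -> linear (line N t).
Proof.
by move=> lN; apply: linear_add; [move=> a x y | apply: linear_scale].
Qed.

(** The common shape of the deformed bracket and of the deformed action. *)
Definition nij_product (K : fieldType) (U V W : lmodType K) (b : U -> V -> W)
    (A : U -> U) (B : V -> V) (C : W -> W) (x : U) (y : V) : W :=
  b (A x) y + b x (B y) - C (b x y).

Section NijenhuisProduct.
Variables (K : fieldType) (U V W : lmodType K) (b : U -> V -> W).
Variables (A : U -> U) (B : V -> V) (C : W -> W).
Hypotheses (bb : bilin b) (lA : linear A) (lB : linear B) (lC : linear C).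

Lemma nij_product_bilin : bilin (nij_product b A B C).
Proof.
split=> z.
  exact: linear_sub (linear_add (linear_comp (bb.1 z) lA) (bb.1 (B z)))
                    (linear_comp lC (bb.1 z)).
exact: linear_sub (linear_add (bb.2 (A z)) (linear_comp (bb.2 z) lB))
                  (linear_comp lC (bb.2 z)).
Qed.

(** The coefficients of 1 and t match by definition of the Nijenhuis product;
    the hypothesis is the equality of the coefficients of t ^ 2. *)
Lemma line_nij_product x y t :
  C (nij_product b A B C x y) = b (A x) (B y) ->
  line C t (b x y + t *: nij_product b A B C x y) = b (line A t x) (line B t y).
Proof.
move=> quad.
rewrite /line (linD lC) (linZ lC) quad !(bilinDl bb, bilinDr bb).
rewrite !(bilinZl bb, bilinZr bb) [t *: (C _ + _)]scalerDr.
rewrite -!addrA; congr (_ + _); rewrite !addrA; congr (_ + _).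
by rewrite -!scalerDr subrK addrC.
Qed.

End NijenhuisProduct.

(** * Polynomial maps with values in a module *)

Section PolynomialMap.
Variable K : fieldType.

(** Horner form: a polynomial map is 0 or c + t h(t) with h polynomial. It
    makes the closure properties and the coefficient-wise division by the
    pencil id + t N direct structural inductions. *)
Inductive polynomial_map (V : lmodType K) : (K -> V) -> Prop :=
| PolynomialZero f of (forall t, f t = 0) : polynomial_map f
| PolynomialHorner c h f of polynomial_map h & (forall t, f t = c + t *: h t) :
    polynomial_map f.

Lemma polynomial_const (V : lmodType K) (c : V) : polynomial_map (fun _ => c).
Proof.
apply: (@PolynomialHorner _ c (fun _ => 0)); first exact: PolynomialZero.
by move=> t; rewrite scaler0 addr0.
Qed.

Lemma polynomial_ext (V : lmodType K) (f h : K -> V) :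
  polynomial_map f -> (forall t, h t = f t) -> polynomial_map h.
Proof.
case=> [f0 f0E | c k f0 pk f0E] hE.
  by apply: PolynomialZero => t; rewrite hE.
by apply: (PolynomialHorner pk) => t; rewrite hE f0E.
Qed.

Lemma polynomial_add (V : lmodType K) (f h : K -> V) :
  polynomial_map f -> polynomial_map h -> polynomial_map (fun t => f t + h t).
Proof.
move=> pf; elim: pf h => {f} [f fE | c k f _ IH fE] h ph.
  by apply: polynomial_ext ph _ => t; rewrite fE add0r.
case: ph => [h0 hE | d l h0 pl hE].
  apply: (PolynomialHorner (IH _ (polynomial_const 0))) => t.
  by rewrite fE hE !addr0.
apply: (PolynomialHorner (IH _ pl)) => t.
by rewrite fE hE scalerDr addrACA.
Qed.

Lemma polynomial_mulX (V : lmodType K) (f : K -> V) :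
  polynomial_map f -> polynomial_map (fun t => t *: f t).
Proof. by move=> pf; apply: (PolynomialHorner (c := 0) pf) => t; rewrite add0r. Qed.

Lemma polynomial_linear (V W : lmodType K) (p : V -> W) (f : K -> V) :
  linear p -> polynomial_map f -> polynomial_map (fun t => p (f t)).
Proof.
move=> lp; elim=> {f} [f fE | c h f _ IH fE].
  by apply: PolynomialZero => t; rewrite fE lin0.
by apply: (PolynomialHorner IH) => t; rewrite fE linD // linZ.
Qed.

Lemma polynomial_sub (V : lmodType K) (f h : K -> V) :
  polynomial_map f -> polynomial_map h -> polynomial_map (fun t => f t - h t).
Proof.
move=> pf ph; apply: polynomial_add => //.
by apply: (@polynomial_linear _ _ -%R) => // a x y; rewrite opprD scalerN.
Qed.

Lemma polynomial_bilin (U V W : lmodType K) (b : U -> V -> W) f h :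
  bilin b -> polynomial_map f -> polynomial_map h ->
  polynomial_map (fun t => b (f t) (h t)).
Proof.
move=> bb pf ph; elim: pf => {f} [f fE | c k f _ IH fE].
  by apply: PolynomialZero => t; rewrite fE (lin0 (bb.1 _)).
apply: polynomial_ext
  (polynomial_add (polynomial_linear (bb.2 c) ph) (polynomial_mulX IH)) _ => t.
by rewrite fE (bilinDl bb) (bilinZl bb).
Qed.

Lemma polynomial_coefs (V : lmodType K) (f : K -> V) :
  polynomial_map f ->
  exists n (v : nat -> V), forall t, f t = \sum_(i < n) t ^+ i *: v i.
Proof.
elim=> {f} [f fE | c h f _ [n [v hE]] fE].
  by exists 0, (fun _ => 0) => t; rewrite fE big_ord0.
exists n.+1, (fun i => if i is j.+1 then v j else c) => t.
rewrite fE hE big_ord_recl /= expr0 scale1r scaler_sumr; congr (_ + _).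
by apply: eq_bigr => i _; rewrite scalerA -exprS.
Qed.

Hypothesis charK : [pchar K] =i pred0.

Lemma pow2_neq1 n : (2 : K) ^+ n.+1 - 1 != 0.
Proof.
have pow_gt1 : (1 < 2 ^ n.+1)%N by rewrite -{1}(expn0 2) ltn_exp2l.
rewrite -natrX -[X in _ - X]mulr1n -natrB 1?ltnW // ((pcharf0P K).1 charK).
by rewrite subn_eq0 -ltnNge.
Qed.

(** An infinite-field argument by dilation: if f has degree at most n + 1, then
    f(2t) - 2^(n+1) f(t) has degree at most n, still vanishes off 0, and its
    constant term is (1 - 2^(n+1)) times that of f. *)
Lemma constant_coef_eq0 (V : lmodType K) n (v : nat -> V) :
  (forall t, t != 0 -> \sum_(i < n.+1) t ^+ i *: v i = 0) -> v 0 = 0.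
Proof.
elim: n v => [|n IH] v v0.
  by have := v0 1 (oner_neq0 _); rewrite big_ord1 expr0 scale1r.
have two_neq0 : (2 : K) != 0 by rewrite ((pcharf0P K).1 charK).
have /eqP : (1 - 2 ^+ n.+1 : K) *: v 0 = 0.
  have := IH (fun i => (2 ^+ i - 2 ^+ n.+1) *: v i); rewrite expr0; apply=> t t0.
  have dilE i : t ^+ i *: ((2 ^+ i - 2 ^+ n.+1) *: v i) =
                (2 * t) ^+ i *: v i - 2 ^+ n.+1 *: (t ^+ i *: v i).
    by rewrite exprMn !scalerA mulrBr scalerBl ![t ^+ i * _]mulrC.
  transitivity (\sum_(i < n.+2) t ^+ i *: ((2 ^+ i - 2 ^+ n.+1) *: v i)).
    by rewrite [RHS]big_ord_recr /= subrr scale0r scaler0 addr0.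
  rewrite (eq_bigr _ (fun (i : 'I_n.+2) _ => dilE i)) sumrB -scaler_sumr.
  by rewrite !v0 ?mulf_neq0 // scaler0 subr0.
by rewrite scaler_eq0 -opprB oppr_eq0 (negPf (pow2_neq1 n)) => /eqP.
Qed.

Lemma polynomial_map_eq0 (V : lmodType K) (f : K -> V) :
  polynomial_map f -> (forall t, t != 0 -> f t = 0) -> forall t, f t = 0.
Proof.
move=> /polynomial_coefs [[|n] [v fE]] f0 t; first by rewrite fE big_ord0.
have [->|/f0 //] := eqVneq t 0.
rewrite fE big_ord_recl /= expr0 scale1r big1 ?addr0; last first.
  by move=> i _; rewrite expr0n scale0r.
by apply: (@constant_coef_eq0 _ n v) => s s0; rewrite -fE f0.
Qed.

(** At t = 0 the hypothesis kills the constant term c of f = c + t h; dividing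
    by t, the quotient h satisfies the same hypothesis for t != 0, hence also
    at 0 since (id + t N) h(t) is polynomial. *)
Lemma polynomial_map_line_eq0 (V : lmodType K) (N : V -> V) (f : K -> V) :
  linear N -> polynomial_map f -> (forall t, line N t (f t) = 0) ->
  forall t, f t = 0.
Proof.
move=> lN; elim=> {f} [//| c h f ph IH fE] Nf0.
have c0 : c = 0 by have := Nf0 0; rewrite /line fE !scale0r !addr0.
have ftE t : f t = t *: h t by rewrite fE c0 add0r.
move=> t; rewrite ftE IH ?scaler0 // => {}t.
apply: (polynomial_map_eq0 (f := fun t => line N t (h t))).
  by apply: polynomial_add => //; apply/polynomial_mulX/polynomial_linear.
move=> s s0; apply/eqP; have /eqP := Nf0 s.
by rewrite ftE (linZ (line_linear s lN)) scaler_eq0 (negPf s0).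
Qed.

Lemma polynomial_map_line_inj (V : lmodType K) (N : V -> V) (f h : K -> V) :
  linear N -> polynomial_map f -> polynomial_map h ->
  (forall t, line N t (f t) = line N t (h t)) -> forall t, f t = h t.
Proof.
move=> lN pf ph eq_fh t; apply/eqP; rewrite -subr_eq0; apply/eqP.
apply: (polynomial_map_line_eq0 lN (polynomial_sub pf ph)) => s.
by rewrite (linB (line_linear s lN)) eq_fh subrr.
Qed.

(** The deformed operations are polynomial in the parameter, including when
    their arguments already depend on it, as in nested brackets. *)
Lemma polynomial_deformed_bilin (U V W : lmodType K) (b w : U -> V -> W) f h :
  bilin b -> bilin w -> polynomial_map f -> polynomial_map h ->
  polynomial_map (fun t => b (f t) (h t) + t *: w (f t) (h t)).
Proof.
move=> bb bw pf ph; apply: polynomial_add; first exact: polynomial_bilin.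
exact/polynomial_mulX/polynomial_bilin.
Qed.

Lemma polynomial_deformed_linear (U V : lmodType K) (p q : U -> V) f :
  linear p -> linear q -> polynomial_map f ->
  polynomial_map (fun t => p (f t) + t *: q (f t)).
Proof.
move=> lp lq pf; apply: polynomial_add; first exact: polynomial_linear.
exact/polynomial_mulX/polynomial_linear.
Qed.

End PolynomialMap.

(** * The deformation generated by a Nijenhuis operator *)

Lemma malcev_alternating (K : fieldType) (g : lmodType K) (br : g -> g -> g) :
  [pchar K] =i pred0 -> is_malcev br -> forall x, br x x = 0.
Proof.
move=> charK mal x; have /eqP := malcev_skew mal x x.
rewrite -addr_eq0 -mulr2n -scaler_nat scaler_eq0 ((pcharf0P K).1 charK) /=.
by move/eqP.
Qed.

Section NijenhuisDeformation.
Variables (K : fieldType) (M g : lmodType K) (E : triple M g).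
Variables (N0 : {linear M -> M}) (N1 : {linear g -> g}).
Hypotheses (charK : [pchar K] =i pred0) (hE : is_embedding_tensor E).
Hypothesis hN : is_nijenhuis E N0 N1.

Let br_bilin : bilin (bracket E) := malcev_bilinear (et_malcev hE).
Let act_bilin : bilin (action E) := rep_bilinear (et_representation hE).
Let N0_linear : linear N0 := linearP N0.
Let N1_linear : linear N1 := linearP N1.

Local Notation theta := (nij_tensor E N0 N1).
Local Notation omega := (nij_bracket E N1).
Local Notation nu := (nij_action E N0 N1).
Local Notation def t := (deform E theta omega nu t).
Local Notation T0 := (line N0).
Local Notation T1 := (line N1).

Lemma nij_bracket_bilin : bilin omega.
Proof. exact: (nij_product_bilin br_bilin N1_linear N1_linear N1_linear). Qed.

Lemma nij_action_bilin : bilin nu.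
Proof. exact: (nij_product_bilin act_bilin N1_linear N0_linear N0_linear). Qed.

Lemma nij_tensor_linear : linear theta.
Proof.
apply: linear_sub; first exact: linear_comp (et_linear hE) N0_linear.
exact: linear_comp N1_linear (et_linear hE).
Qed.

Lemma nijenhuis_morphism t : is_morphism (def t) E (T0 t) (T1 t).
Proof.
split=> /=.
- exact: line_linear.
- exact: line_linear.
- move=> m; rewrite /line (linD (et_linear hE)) (linZ (et_linear hE)).
  rewrite (linD N1_linear) (linZ N1_linear) (nijenhuis_tensor hN) scaler0 addr0.
  by rewrite -addrA -scalerDr subrK.
- move=> x y; apply: (line_nij_product br_bilin) => //.
  exact: (nijenhuis_bracket hN).
- move=> x m; apply: (line_nij_product act_bilin) => //.
  exact: (nijenhuis_action hN).
Qed.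

(* Pushing T0 t and T1 t through an expression in the deformed operations. *)
Let T1D t := linD (line_linear t N1_linear).
Let T0D t := linD (line_linear t N0_linear).
Let T0B t := linB (line_linear t N0_linear).
Let T1br t := morph_bracket (nijenhuis_morphism t).
Let T0act t := morph_action (nijenhuis_morphism t).
Let T1T t := morph_tensor (nijenhuis_morphism t).

Lemma polynomial_deformed_bracket (f h : K -> g) :
  polynomial_map f -> polynomial_map h ->
  polynomial_map (fun t => bracket (def t) (f t) (h t)).
Proof. exact: polynomial_deformed_bilin br_bilin nij_bracket_bilin. Qed.

Lemma polynomial_deformed_action (f : K -> g) (h : K -> M) :
  polynomial_map f -> polynomial_map h ->
  polynomial_map (fun t => action (def t) (f t) (h t)).
Proof. exact: polynomial_deformed_bilin act_bilin nij_action_bilin. Qed.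

Lemma polynomial_deformed_tensor (f : K -> M) :
  polynomial_map f -> polynomial_map (fun t => tensor (def t) (f t)).
Proof. exact: polynomial_deformed_linear (et_linear hE) nij_tensor_linear. Qed.

Lemma polynomial_deformed_jacobian (f h k : K -> g) :
  polynomial_map f -> polynomial_map h -> polynomial_map k ->
  polynomial_map (fun t => jacobian (bracket (def t)) (f t) (h t) (k t)).
Proof.
move=> pf ph pk; have pbr := polynomial_deformed_bracket.
by apply: polynomial_add; [apply: polynomial_add|]; apply: (pbr) => //;
   apply: pbr.
Qed.

Lemma line_jacobian t x y z :
  T1 t (jacobian (bracket (def t)) x y z) =
  jacobian (bracket E) (T1 t x) (T1 t y) (T1 t z).
Proof.
(* The deformed bracket is itself convertible to a sum, so T1D must be used
   exactly on the two outer additions. *)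
by rewrite /jacobian T1D T1D !T1br.
Qed.

Lemma deformed_malcev t : is_malcev (bracket (def t)).
Proof.
have mal := et_malcev hE; have pc := @polynomial_const K g.
split.
- exact: bilin_addscale br_bilin nij_bracket_bilin.
- move=> x y /=; rewrite /nij_bracket opprD -scalerN; congr (_ + _ *: _).
    exact: malcev_skew.
  rewrite (malcev_skew mal (N1 x)) (malcev_skew mal x (N1 y)).
  rewrite (malcev_skew mal x y) raddfN !opprD.
  by rewrite [- _ - bracket E (N1 y) x]addrC.
- move=> x y z; move: t.
  apply: (polynomial_map_line_inj charK N1_linear) => [||t].
  + apply: polynomial_deformed_jacobian => //.
    exact: polynomial_deformed_bracket.
  + apply: polynomial_deformed_bracket => //.
    exact: polynomial_deformed_jacobian.
  by rewrite T1br !line_jacobian T1br (malcev_identity mal).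
Qed.

Lemma deformed_representation t :
  is_representation (bracket (def t)) (action (def t)).
Proof.
have rep := et_representation hE.
have pc := @polynomial_const K g; have pcM := @polynomial_const K M.
have pbr := polynomial_deformed_bracket.
have pact := polynomial_deformed_action.
split.
  exact: bilin_addscale act_bilin nij_action_bilin.
move=> x y z m; move: t.
apply: (polynomial_map_line_inj charK N0_linear) => [||t].
- by apply: (pact) => //; apply: (pbr) => //; apply: pbr.
- apply: polynomial_sub; last by apply: (pact); [apply: pbr | apply: pact].
  apply: polynomial_add; last first.
    by apply: (pact) => //; apply: (pact) => //; apply: pbr.
  by apply: polynomial_sub; do 3 ?[apply: (pact) => //].
by rewrite T0B T0D T0B !T0act !T1br (rep_identity rep).
Qed.

Lemma deformed_embedding_tensor t : is_embedding_tensor (def t).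
Proof.
have pcM := @polynomial_const K M.
have pT := polynomial_deformed_tensor.
split.
- exact: deformed_malcev.
- exact: deformed_representation.
- apply: linear_add; first exact: et_linear hE.
  exact: linear_scale nij_tensor_linear.
- move=> m n; move: t.
  apply: (polynomial_map_line_inj charK N1_linear) => [||t].
  + by apply: polynomial_deformed_bracket; apply: pT.
  + by apply: (pT); apply: polynomial_deformed_action => //; apply: pT.
  by rewrite T1br -!T1T T0act -T1T (et_identity hE).
Qed.

End NijenhuisDeformation.

Theorem theorem5p4 (K : fieldType) (charK : [pchar K] =i pred0)
    (M g : lmodType K) (E : triple M g) (hE : is_embedding_tensor E)
    (N0 : {linear M -> M}) (N1 : {linear g -> g}) (hN : is_nijenhuis E N0 N1) :
  generates_deformation E
    (nij_tensor E N0 N1) (nij_bracket E N1) (nij_action E N0 N1)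
  /\ is_trivial_deformation E
    (nij_tensor E N0 N1) (nij_bracket E N1) (nij_action E N0 N1).
Proof.
split; last by exists N0, N1 => lambda; exact: nijenhuis_morphism.
split.
- exact: nij_tensor_linear.
- exact: nij_bracket_bilin.
- move=> x; have alt := malcev_alternating charK (et_malcev hE).
  by rewrite /nij_bracket alt raddf0 subr0 (malcev_skew (et_malcev hE)) addNr.
- exact: nij_action_bilin.
- exact: deformed_embedding_tensor.
Qed.
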